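(* For all constant integers $t', t$ with $2 \leq t' \leq t$, the problem $t'$-\textsc{Isp-Ot} is polynomial-time many-one reducible to $t$-\textsc{Isp-Ot}.
   Context: A propositional CNF formula $\varphi$ is given over Boolean features $\mathcal{F}$, with a set $\mathcal{C}\subseteq\mathcal{F}$ of concrete features. Configurations are satisfying assignments of $\varphi$, viewed as sets of literals. A true interaction of size $t$ is a set of $t$ non-negated concrete features (positive literals); it is feasible if some satisfying assignment sets all of them to true (and is then covered by that assignment). The decision problem $t$-\textsc{Isp-Ot}: given $(\varphi,\mathcal{F},\mathcal{C},s)$, decide whether there is a set of at most $s$ satisfying assignments of $\varphi$ such that every feasible true interaction of size $t$ is covered by one of them. *)

(* Defs.v *)
From Corelib Require Import BinNums.
From mathcomp Require Import all_boot all_order all_algebra.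

Set Implicit Arguments.
Unset Strict Implicit.
Unset Printing Implicit Defensive.

(** * Decision problems and polynomial-time many-one reductions *)

(* The input alphabet: Some false = 0, Some true = 1, None = separator. *)
Definition symbol : finType := option bool.

(* A decision problem is a set of instances with a yes-predicate, together with
   an injective encoding of the instances as strings. *)
Record problem := Problem {
  instance : Type;
  encode : instance -> seq symbol;
  encode_inj : injective encode;
  yes : instance -> Prop
}.

Inductive move := GoLeft | Stay | GoRight.

(* Deterministic Turing machines with [extra_tapes.+1] tapes.  A cell is blank
   ([None]) or contains an input symbol ([inl]) or a work symbol ([inr]).  The
   transition function maps the current state and the scanned symbols to the
   next state and, for each tape, the symbol to write and the head move. *)
Record machine := Machine {
  state : finType;
  work : finType;
  extra_tapes : nat;
  start : state;
  halting : pred state;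
  delta : state -> {ffun 'I_extra_tapes.+1 -> option (symbol + work)} ->
          state * ('I_extra_tapes.+1 -> option (symbol + work) * move)
}.

Section Run.
Variable M : machine.

Definition cell : Type := option (symbol + work M).

(* Tapes are infinite to the right only. *)
Record tape := Tape { content : nat -> cell; head_pos : nat }.

Record config := Config {
  cstate : state M;
  ctape : 'I_(extra_tapes M).+1 -> tape
}.

Definition string_content (w : seq symbol) : nat -> cell :=
  nth None [seq Some (inl x) | x <- w].

(* The input is on the first tape and the output is read on the last one. *)
Definition init (w : seq symbol) : config :=
  Config (start M)
    (fun k => Tape (string_content (if k == ord0 then w else [::])) 0).

(* Moving left from the leftmost cell leaves the head there. *)
Definition move_head (d : move) (h : nat) : nat :=
  match d with GoLeft => h.-1 | Stay => h | GoRight => h.+1 end.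

Definition act_tape (a : cell * move) (tp : tape) : tape :=
  Tape (fun i => if i == head_pos tp then a.1 else content tp i)
       (move_head a.2 (head_pos tp)).

Definition step (c : config) : config :=
  if halting (cstate c) then c else
  let r := delta (cstate c)
             [ffun k => content (ctape c k) (head_pos (ctape c k))] in
  Config r.1 (fun k => act_tape (r.2 k) (ctape c k)).

(* Within [n] steps on input [w], the machine halts with exactly [v] on its
   output tape; halting configurations are fixed by [step]. *)
Definition outputs_within (n : nat) (w v : seq symbol) : Prop :=
  let c := iter n step (init w) in
  halting (cstate c) /\ content (ctape c ord_max) =1 string_content v.

End Run.

Definition polytime_computable (P Q : problem) (f : instance P -> instance Q) :
    Prop :=
  exists (M : machine) (p : {poly nat}), forall x : instance P,
    outputs_within M (p.[size (encode x)])%R (encode x) (encode (f x)).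

Definition polytime_many_one_reducible (P Q : problem) : Prop :=
  exists f : instance P -> instance Q,
    polytime_computable f /\ forall x : instance P, yes x <-> yes (f x).

(** * The problem t-ISP-OT *)

(* [(f, true)] is the feature [f], [(f, false)] its negation. *)
Definition literal (n : nat) : finType := ('I_n * bool)%type.

Definition cnf (n : nat) : Type := seq (seq (literal n)).

(* The set of features is [{0, ..., nfeatures - 1}]. *)
Record isp_instance := IspInstance {
  nfeatures : nat;
  formula : cnf nfeatures;
  concrete : {set 'I_nfeatures};
  bound : nat
}.

Section Configurations.
Variable n : nat.

Definition assignment : finType := {ffun 'I_n -> bool}.

Definition literals (a : assignment) : {set literal n} :=
  [set l | a l.1 == l.2].

Definition satisfies (a : assignment) (phi : cnf n) : bool :=
  all (fun c : seq (literal n) => has (fun l => l \in literals a) c) phi.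

Definition true_interaction (t : nat) (C : {set 'I_n}) (T : {set literal n}) :
    bool :=
  (#|T| == t) && [forall l in T, l.2 && (l.1 \in C)].

Definition covers (a : assignment) (T : {set literal n}) : bool :=
  T \subset literals a.

Definition feasible (phi : cnf n) (T : {set literal n}) : Prop :=
  exists a : assignment, satisfies a phi /\ covers a T.

End Configurations.

Definition isp_ot_yes (t : nat) (x : isp_instance) : Prop :=
  exists S : {set assignment (nfeatures x)},
    [/\ #|S| <= bound x,
        forall a, a \in S -> satisfies a (formula x)
      & forall T, true_interaction t (concrete x) T -> feasible (formula x) T ->
          exists2 a, a \in S & covers a T].

(** ** Encoding of the instances *)

Fixpoint bits_of_pos (p : positive) : seq bool :=
  match p with
  | xH => [:: true]
  | xO q => false :: bits_of_pos q
  | xI q => true :: bits_of_pos q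
  end.

(* Binary expansion, least significant bit first, empty for 0. *)
Definition bits (m : nat) : seq bool :=
  if bin_of_nat m is Npos p then bits_of_pos p else [::].

(* A word of bits followed by a separator. *)
Definition encode_bits (w : seq bool) : seq symbol := rcons (map Some w) None.

(* Sign bit, index in binary, separator. *)
Definition encode_literal n (l : literal n) : seq symbol :=
  encode_bits (l.2 :: bits l.1).

Definition encode_clause n (c : seq (literal n)) : seq symbol :=
  rcons (flatten (map (@encode_literal n) c)) None.

Definition encode_cnf n (phi : cnf n) : seq symbol :=
  flatten (map (@encode_clause n) phi).

(* The features are listed by one bit each, telling whether the feature is
   concrete; the bound is in binary. *)
Definition encode_isp (x : isp_instance) : seq symbol :=
  encode_bits [seq i \in concrete x | i <- enum 'I_(nfeatures x)]
  ++ encode_bits (bits (bound x)) ++ encode_cnf (formula x).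

Lemma bits_of_pos_inj : injective bits_of_pos.
Proof.
have nz p : bits_of_pos p = [::] -> False by case: p.
elim=> [p IH|p IH|] [q|q|] //= [].
- by move/IH->.
- by move/nz.
- by move/IH->.
- by move/esym/nz.
Qed.

Lemma bits_inj : injective bits.
Proof.
move=> m k; rewrite /bits => e; apply: (can_inj bin_of_natK); move: e.
case: (bin_of_nat m) => [|p]; case: (bin_of_nat k) => [|q] //.
- by case: q.
- by case: p.
- by move/bits_of_pos_inj->.
Qed.

Lemma encode_bits_cat (w1 w2 : seq bool) (r1 r2 : seq symbol) :
  encode_bits w1 ++ r1 = encode_bits w2 ++ r2 -> w1 = w2 /\ r1 = r2.
Proof.
rewrite /encode_bits.
elim: w1 w2 => [|b w1 IH] [|b2 w2] //=; first by case.
by case=> -> /IH [-> ->].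
Qed.

Lemma encode_clause_cat n (c1 c2 : seq (literal n)) (r1 r2 : seq symbol) :
  encode_clause c1 ++ r1 = encode_clause c2 ++ r2 -> c1 = c2 /\ r1 = r2.
Proof.
rewrite /encode_clause.
elim: c1 c2 => [|l c1 IH] [|l2 c2] //=; first by case.
rewrite !rcons_cat -!catA => /(@encode_bits_cat (_ :: _) (_ :: _)).
case=> -[e1 /bits_inj/val_inj e2] /IH [-> ->]; split=> //; congr cons.
by case: l l2 e1 e2 => ? ? [? ?] /= -> ->.
Qed.

Lemma encode_cnf_inj n : injective (@encode_cnf n).
Proof.
have nz (c : seq (literal n)) r : encode_clause c ++ r = [::] -> False.
  by rewrite /encode_clause cat_rcons; case: (flatten _).
rewrite /encode_cnf; elim=> [|c1 p1 IH] [|c2 p2] //=.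
- by move/esym/nz.
- by move/nz.
- by move/encode_clause_cat=> [-> /IH ->].
Qed.

Lemma encode_isp_inj : injective encode_isp.
Proof.
case=> [n phi C s] [n' phi' C' s']; rewrite /encode_isp /=.
case/encode_bits_cat=> eC /encode_bits_cat [/bits_inj -> e].
have sz k (D : {set 'I_k}) : size [seq i \in D | i <- enum 'I_k] = k.
  by rewrite size_map size_enum_ord.
have en : n = n' by rewrite -(sz _ C) eC sz.
case: n' / en phi' C' eC e => phi' C' eC /encode_cnf_inj ->.
suff -> : C = C' by [].
by apply/setP=> i; move/eq_in_map: eC; apply; rewrite mem_enum.
Qed.

Definition isp_ot (t : nat) : problem :=
  Problem encode_isp_inj (isp_ot_yes t).

(* Main.v *)
Require Import Defs.
From mathcomp Require Import all_boot all_algebra.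
From mathcomp Require Import zify.

Set Implicit Arguments.
Unset Strict Implicit.
Unset Printing Implicit Defensive.

(** Let [d = t - t'].  Add concrete features [y_1, ..., y_d] and
    [w_1, ..., w_{t'+1}], weaken every clause by the disjunct
    [~y_1 \/ ... \/ ~y_d], add the clauses [~w_j \/ ~y_1 \/ ... \/ ~y_d], and
    raise the bound by [d].  A feasible interaction of size [t] containing all
    the [y]'s consists of them and of an interaction of size [t'] feasible for
    the old formula; one that misses [y_i] is covered by the assignment with
    only [y_i] false.  Conversely, the interaction made of all the [w]'s and of
    all the [y]'s but [y_i] is only covered by assignments where [y_i] is the
    only false [y], so [d] assignments of any solution are useless for the
    interactions containing all the [y]'s.

    If the new features come first, the old indices are shifted by a constant.
    Adding a constant to a binary number with least significant bit first only
    needs a bounded carry, so that the whole reduction is computed by a one-way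
    finite-state transducer, hence by a Turing machine in linear time. *)

(** * Linear-time simulation of a one-way transducer by a two-tape machine *)

Section Transducer.
Variables (Q : finType) (q0 : Q) (tr : Q -> symbol -> Q * seq symbol).

Fixpoint transduce (q : Q) (w : seq symbol) : seq symbol :=
  if w is a :: w' then (tr q a).2 ++ transduce (tr q a).1 w' else [::].

Definition max_emit : nat := \max_(p : Q * symbol) size (tr p.1 p.2).2.

Lemma size_emit q a : size (tr q a).2 <= max_emit.
Proof. exact: (leq_bigmax (F := fun p => size (tr p.1 p.2).2) (q, a)). Qed.

(* In state [Some (q, i)] the input head rests on the current symbol until all
   of its output word has been emitted; [i] counts the symbols already emitted.
   [None] is the halting state, reached on the first blank. *)
Definition transducer_delta (s : option (Q * 'I_max_emit.+1))
    (r : {ffun 'I_2 -> option (symbol + void)}) :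
    option (Q * 'I_max_emit.+1) * ('I_2 -> option (symbol + void) * move) :=
  match s, r ord0 with
  | Some (q, i), Some (inl a) =>
    if i < size (tr q a).2 then
      (Some (q, inord i.+1),
       fun k => if k == ord0 then (r k, Stay)
                else (Some (inl (nth None (tr q a).2 i)), GoRight))
    else (Some ((tr q a).1, ord0),
          fun k => (r k, if k == ord0 then GoRight else Stay))
  | _, _ => (None, fun k => (r k, Stay))
  end.

Definition transducer_machine : machine :=
  @Machine (option (Q * 'I_max_emit.+1)) void 1 (Some (q0, ord0))
    (fun s => s == None) transducer_delta.

Definition represents (c : config transducer_machine)
    (s : option (Q * 'I_max_emit.+1)) (w : seq symbol) (h : nat)
    (v : seq symbol) : Prop :=
  [/\ cstate c = s,
      content (ctape c ord0) =1 string_content transducer_machine w,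
      head_pos (ctape c ord0) = h,
      content (ctape c ord_max) =1 string_content transducer_machine v
    & head_pos (ctape c ord_max) = size v].

Lemma string_content_rcons (M : machine) v x i :
  string_content M (rcons v x) i =
  if i == size v then Some (inl x) else string_content M v i.
Proof.
rewrite /string_content map_rcons nth_rcons size_map.
case: ltngtP => // ltvi; by rewrite nth_default // size_map ltnW.
Qed.

Lemma step_emit c q i w h v a :
  represents c (Some (q, i)) w h v ->
  string_content transducer_machine w h = Some (inl a) ->
  i < size (tr q a).2 ->
  represents (step c) (Some (q, inord i.+1)) w h (rcons v (nth None (tr q a).2 i)).
Proof.
case: c => s tp [/= -> cin hin cout hout] wh lti; rewrite /step /=.
rewrite /transducer_delta ffunE cin hin wh lti.
split=> //=.
- by move=> j /=; rewrite ffunE; case: eqP => // ->.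
- by move=> j; rewrite string_content_rcons hout cout.
- by rewrite hout size_rcons.
Qed.

Lemma step_advance c q i w h v a :
  represents c (Some (q, i)) w h v ->
  string_content transducer_machine w h = Some (inl a) ->
  size (tr q a).2 <= i ->
  represents (step c) (Some ((tr q a).1, ord0)) w h.+1 v.
Proof.
case: c => s tp [/= -> cin hin cout hout] wh lei; rewrite /step /=.
rewrite /transducer_delta ffunE cin hin wh ltnNge lei.
split=> //=; last 1 first.
- by move=> j /=; rewrite ffunE; case: eqP => // ->.
- by move=> j /=; rewrite ffunE; case: eqP => // ->.
- by rewrite hin.
Qed.

Lemma step_halt c q i w v :
  represents c (Some (q, i)) w (size w) v ->
  represents (step c) None w (size w) v.
Proof.
case: c => s tp [/= -> cin hin cout hout]; rewrite /step /=.
rewrite /transducer_delta ffunE cin hin.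
have -> : string_content transducer_machine w (size w) = None.
  by rewrite /string_content nth_default // size_map.
split=> //=.
- by move=> j /=; rewrite ffunE; case: eqP => // ->.
- by move=> j /=; rewrite ffunE; case: eqP => // ->.
Qed.

Lemma iter_symbol n c q i w h v a :
  represents c (Some (q, i)) w h v ->
  string_content transducer_machine w h = Some (inl a) ->
  i + n = size (tr q a).2 ->
  represents (iter n.+1 (@step _) c) (Some ((tr q a).1, ord0)) w h.+1
    (v ++ drop i (tr q a).2).
Proof.
elim: n c i v => [|n IH] c i v rep wh ein.
  rewrite addn0 in ein; rewrite ein drop_size cats0.
  by apply: step_advance rep wh _; rewrite ein.
have lti : i < size (tr q a).2 by rewrite -ein; lia.
rewrite iterSr (drop_nth None) // -cat_rcons.
(* [inord] is faithful here: [i.+1] is at most the length of the emitted word, hence at most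
   [max_emit]. *)
have ei : (inord i.+1 : 'I_max_emit.+1) = i.+1 :> nat.
  by rewrite inordK // ltnS (leq_trans lti) ?size_emit.
have := IH _ _ _ (step_emit rep wh lti) wh; rewrite ei; apply; lia.
Qed.

(** Each input symbol costs one step per emitted symbol and one to advance the input head; the last
    [1] is the halting step on the first blank. *)
Lemma iter_word w1 w2 c q v :
  represents c (Some (q, ord0)) (w1 ++ w2) (size w1) v ->
  exists2 n, n <= max_emit.+1 * size w2 + 1 &
    represents (iter n (@step _) c) None (w1 ++ w2) (size (w1 ++ w2))
      (v ++ transduce q w2).
Proof.
elim: w2 w1 c q v => [|a w2 IH] w1 c q v rep.
  exists 1; first by rewrite leq_addl.
  by rewrite !cats0 in rep *; apply: step_halt rep.
have wh : string_content transducer_machine (w1 ++ a :: w2) (size w1) = Some (inl a).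
  by rewrite /string_content map_cat nth_cat size_map ltnn subnn.
have := iter_symbol rep wh (add0n _).
rewrite drop0 -cat_rcons -(size_rcons w1 a) => /IH [n len repn].
exists (n + (size (tr q a).2).+1).
  have := size_emit q a; move: len; rewrite [size (a :: w2)]/= mulnS.
  by move: (_ * _) => p; lia.
by rewrite iterD /= catA.
Qed.

Lemma iter_halted (M : machine) (c : config M) n :
  halting (cstate c) -> iter n (@step M) c = c.
Proof. by move=> hc; elim: n => //= n ->; rewrite /step hc. Qed.

Lemma transducer_outputs w :
  outputs_within transducer_machine
    (Poly [:: 1; max_emit.+1]).[size w]%R w (transduce q0 w).
Proof.
have rep0 : represents (init transducer_machine w) (Some (q0, ord0))
    ([::] ++ w) (size ([::] : seq symbol)) [::].
  by [].
have [n len rep] := iter_word rep0; rewrite /outputs_within.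
(* Halting configurations are fixed, so the steps left over after the first [n] change nothing. *)
have -> : (Poly [:: 1; max_emit.+1]).[size w]%R = (max_emit.+1 * size w + 1 - n) + n.
  by rewrite horner_Poly /= GRing.mul0r GRing.add0r subnK.
rewrite iterD; case: rep => [es _ _ cout _].
have hn : halting (cstate (iter n (@step _) (init transducer_machine w))).
  by rewrite es.
by rewrite iter_halted.
Qed.

End Transducer.
Lemma bits_odd_half m : 0 < m -> bits m = odd m :: bits m./2.
Proof.
rewrite /bits => m_gt0; rewrite -{2 3}(bin_of_natK m).
have: bin_of_nat m <> BinNums.N0.
  by move=> e; move: m_gt0; rewrite -(bin_of_natK m) e.
case: (bin_of_nat m) => // p _; rewrite /nat_of_bin.
case: p => [p|p|] //=.
- by rewrite NatTrec.doubleE odd_double uphalf_double (nat_of_binK (BinNums.Npos p)).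
- by rewrite NatTrec.doubleE odd_double doubleK (nat_of_binK (BinNums.Npos p)).
Qed.

(** This separates the concreteness flags of the new features from those of the old ones. *)
Lemma map_enum_ordD (T : Type) m n (f : 'I_(m + n) -> T) :
  map f (enum 'I_(m + n)) =
  [seq f (lshift n i) | i <- enum 'I_m] ++ [seq f (rshift m i) | i <- enum 'I_n].
Proof.
rewrite (map_comp f (@lshift m n)) (map_comp f (@rshift m n)) -map_cat.
congr map; apply: (inj_map val_inj); rewrite map_cat val_enum_ord.
rewrite iotaD; congr (_ ++ _); rewrite -map_comp.
  by rewrite -val_enum_ord; apply: eq_map.
by rewrite add0n -[X in iota X]addn0 iotaDl -val_enum_ord -map_comp; apply: eq_map.
Qed.

(** * The reduction and the transducer computing it *)

Section Reduction.
Variables d k : nat.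

Local Notation K := (d + k.+1).

(* The features [y_i] are [lshift k.+1 i]; the features [w_j] are [rshift d j]. *)
Definition some_y_false : seq (literal K) :=
  [seq (lshift k.+1 i, false) | i <- enum 'I_d].

(** The number [k.+1] of [w]'s is chosen so that, with all [y]'s but one, they form an interaction
    of size exactly [d + k]. *)
Definition gadget : cnf K :=
  [seq (rshift d j, false) :: some_y_false | j <- enum 'I_k.+1].

Definition new_literal n (l : literal K) : literal (K + n) := (lshift n l.1, l.2).

Definition old_literal n (l : literal n) : literal (K + n) := (rshift K l.1, l.2).

(** The gadget comes first so that it can be emitted as a fixed word right after the bound, before
    any clause of [phi] is read. *)
Definition reduce_cnf n (phi : cnf n) : cnf (K + n) :=
  map (map (@new_literal n)) gadget ++
  [seq map (@old_literal n) c ++ map (@new_literal n) some_y_false | c <- phi].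

Definition reduce (x : isp_instance) : isp_instance :=
  IspInstance (reduce_cnf (formula x))
    [set i | if split i is inr j then j \in concrete x else true]
    (d + bound x).

(* [inr (Some b)]: reading the concreteness flags, [b] at the first symbol;
   [inr None]: a sign bit or the end of a clause comes next;
   [inl (b, c)]: adding the carry [c] to a binary number, the bound if [b] and
   an index otherwise. *)
Definition reduce_state : finType := ((bool * 'I_K.+1) + option bool)%type.

Definition reduce_trans (q : reduce_state) (a : symbol) :
    reduce_state * seq symbol :=
  match q, a with
  | inr (Some b), _ =>
    (if a is Some _ then inr (Some false) else inl (true, inord d),
     (if b then nseq K (Some true) else [::]) ++ [:: a])
  | inl (b, c), Some e => (inl (b, inord (c + e)./2), [:: Some (odd (c + e))])
  | inl (b, c), None =>
    (inr None, encode_bits (bits c) ++ (if b then encode_cnf gadget else [::]))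
  | inr None, Some e => (inl (false, ord_max), [:: Some e])
  | inr None, None => (inr None, encode_clause some_y_false)
  end.

Local Notation run := (transduce reduce_trans).

Lemma run_flags w r :
  run (inr (Some false)) (encode_bits w ++ r) =
  encode_bits w ++ run (inl (true, inord d)) r.
Proof. by elim: w => //= e w ->. Qed.

(** The [K] new flags are emitted at the first symbol, even if that is already the separator because
    [w] is empty. *)
Lemma run_flags_start w r :
  run (inr (Some true)) (encode_bits w ++ r) =
  encode_bits (nseq K true ++ w) ++ run (inl (true, inord d)) r.
Proof.
rewrite /encode_bits map_cat rcons_cat map_nseq -catA.
case: w => [|e w]; rewrite [LHS]/= -catA //.
by rewrite -[rcons _ _]/(encode_bits w) run_flags.
Qed.

(** Ripple carry: once the bit [odd m] is read, [(c + odd m)./2 + m./2] remains to be written. A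
    carry of at most [K] stays so because [K] is positive; when the bits run out, the carry itself
    is written. *)
Lemma run_add b (c : 'I_K.+1) m r :
  run (inl (b, c)) (encode_bits (bits m) ++ r) =
  encode_bits (bits (c + m)) ++ (if b then encode_cnf gadget else [::]) ++
  run (inr None) r.
Proof.
have [N] := ubnP m; elim: N m c => // N IH m c; rewrite ltnS => leN.
have [->|m_gt0] := posnP m; first by rewrite addn0 /= -catA.
rewrite (bits_odd_half m_gt0) [in RHS]bits_odd_half ?addn_gt0 ?m_gt0 ?orbT //=.
rewrite -/(encode_bits _) IH; last by lia.
have -> : (inord (c + odd m)./2 : 'I_K.+1) = (c + odd m)./2 :> nat.
  by rewrite inordK //; have := ltn_ord c; lia.
congr (_ :: _); first by rewrite !oddD; case: (odd m).
congr (encode_bits (bits _) ++ _); lia.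
Qed.

(** The sign bit starts an addition with carry [ord_max], whose value is the shift [K]. *)
Lemma run_literal n (l : literal n) r :
  run (inr None) (encode_literal l ++ r) =
  encode_literal (old_literal l) ++ run (inr None) r.
Proof. by rewrite [LHS]/= -/(encode_bits _) run_add. Qed.

Lemma encode_clause_cons n (l : literal n) c :
  encode_clause (l :: c) = encode_literal l ++ encode_clause c.
Proof. by rewrite /encode_clause /= rcons_cat. Qed.

(** [lshift] keeps the value of an index, so these words do not depend on [n] and can be built into
    the transition function. *)
Lemma encode_new_clause n c :
  encode_clause (map (@new_literal n) c) = encode_clause c.
Proof. by rewrite /encode_clause -map_comp. Qed.

Lemma run_clause n (c : seq (literal n)) r :
  run (inr None) (encode_clause c ++ r) =
  encode_clause (map (@old_literal n) c ++ map (@new_literal n) some_y_false)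
  ++ run (inr None) r.
Proof.
elim: c => [|l c IH]; first by rewrite [LHS]/= encode_new_clause.
by rewrite map_cons cat_cons !encode_clause_cons -!catA run_literal IH.
Qed.

Lemma run_cnf n (phi : cnf n) :
  run (inr None) (encode_cnf phi) =
  encode_cnf
    [seq map (@old_literal n) c ++ map (@new_literal n) some_y_false | c <- phi].
Proof. by rewrite /encode_cnf; elim: phi => //= c phi IH; rewrite run_clause IH. Qed.

Lemma run_encode x : run (inr (Some true)) (encode_isp x) = encode_isp (reduce x).
Proof.
rewrite /encode_isp run_flags_start run_add run_cnf; congr (encode_bits _ ++ _).
  rewrite /= map_enum_ordD; congr (_ ++ _).
    rewrite -{1}(size_enum_ord K); elim: (enum 'I_K) => //= i s ->.
    by rewrite inE (unsplitK (inl i)).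
  by apply/eq_map => i; rewrite inE (unsplitK (inr i)).
rewrite inordK; last by lia.
congr (_ ++ _); rewrite /= /encode_cnf /reduce_cnf map_cat flatten_cat.
congr (_ ++ _); rewrite -map_comp.
by congr flatten; apply/eq_map => c /=; rewrite encode_new_clause.
Qed.

Lemma reduce_polytime t' t : @polytime_computable (isp_ot t') (isp_ot t) reduce.
Proof.
exists (transducer_machine (inr (Some true)) reduce_trans).
eexists => x /=; rewrite -run_encode; exact: transducer_outputs.
Qed.

(** * Correctness of the reduction *)

Section Correctness.
Variable x : isp_instance.

Local Notation n := (nfeatures x).
Local Notation F := 'I_(K + n).
Local Notation phi := (formula x).

Definition yf (i : 'I_d) : F := lshift n (lshift k.+1 i).
Definition wf (j : 'I_k.+1) : F := lshift n (rshift d j).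
Definition oldf (i : 'I_n) : F := rshift K i.

Variant feature_spec : F -> Type :=
  | FeatureY i : feature_spec (yf i)
  | FeatureW j : feature_spec (wf j)
  | FeatureOld i : feature_spec (oldf i).

Lemma featureP f : feature_spec f.
Proof.
rewrite -(splitK f); case: (split f) => [g|i]; last exact: FeatureOld.
rewrite -(splitK g) /=; case: (split g) => [i|j]; first exact: FeatureY.
exact: FeatureW.
Qed.

Lemma yf_inj : injective yf.
Proof. by move=> i j /lshift_inj/lshift_inj. Qed.

Lemma wf_inj : injective wf.
Proof. by move=> i j /lshift_inj/rshift_inj. Qed.

Lemma oldf_inj : injective oldf.
Proof. exact: rshift_inj. Qed.

Lemma wf_yf j i : (wf j == yf i) = false.
Proof. by rewrite /wf /yf (inj_eq (@lshift_inj _ _)) eq_rlshift. Qed.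

Lemma oldf_yf j i : (oldf j == yf i) = false.
Proof. exact: eq_rlshift. Qed.

Lemma concrete_yf i : yf i \in concrete (reduce x).
Proof. by rewrite inE (unsplitK (inl _)). Qed.

Lemma concrete_wf i : wf i \in concrete (reduce x).
Proof. by rewrite inE (unsplitK (inl _)). Qed.

Lemma concrete_oldf i : (oldf i \in concrete (reduce x)) = (i \in concrete x).
Proof. by rewrite inE (unsplitK (inr _)). Qed.

Definition all_y (a : assignment (K + n)) : bool := [forall i, a (yf i)].

(** A false [y] satisfies the disjunct common to all clauses; if there is none, this disjunct drops
    out and leaves the clauses [~w_j] and [phi]. *)
Lemma satisfies_reduce (a : assignment (K + n)) :
  satisfies a (reduce_cnf phi) =
  ~~ all_y a ||
  [forall j, ~~ a (wf j)] && satisfies [ffun i => a (oldf i)] phi.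
Proof.
have hasY : has (fun l => l \in literals a) (map (@new_literal n) some_y_false)
    = ~~ all_y a.
  rewrite has_map has_map; apply/hasP/forallPn => [[i _]|[i nai]].
    by rewrite /= inE eqbF_neg; exists i.
  by exists i; rewrite ?mem_enum //= inE eqbF_neg.
rewrite /satisfies all_cat /gadget -map_comp all_map [X in _ && X]all_map.
have [ay|nay] := boolP (all_y a); rewrite /=; last first.
  by rewrite (eq_all (a2 := predT)) ?all_predT ?(eq_all (a2 := predT))
    ?all_predT // => c /=; rewrite ?has_cat hasY nay orbT.
congr (_ && _).
  apply/allP/forallP => [H j|H j _] /=; last first.
    by rewrite inE eqbF_neg H.
  have := H j; rewrite mem_enum => /(_ isT) /=.
  by rewrite hasY ay orbF inE eqbF_neg.
apply: eq_all => c /=; rewrite has_cat hasY ay orbF has_map.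
by apply: eq_has => l /=; rewrite !inE ffunE.
Qed.

Definition lift_assignment (a : assignment n) : assignment (K + n) :=
  [ffun f => match split f with
             | inl g => if split g is inl _ then true else false
             | inr i => a i end].

Definition junk (i : 'I_d) : assignment (K + n) := [ffun f => f != yf i].

Lemma lift_yf a i : lift_assignment a (yf i) = true.
Proof. by rewrite ffunE (unsplitK (inl _)) (unsplitK (inl _)). Qed.

Lemma lift_wf a i : lift_assignment a (wf i) = false.
Proof. by rewrite ffunE (unsplitK (inl _)) (unsplitK (inr _)). Qed.

Lemma lift_oldf a i : lift_assignment a (oldf i) = a i.
Proof. by rewrite ffunE (unsplitK (inr _)). Qed.

Lemma satisfies_lift a :
  satisfies a phi -> satisfies (lift_assignment a) (reduce_cnf phi).
Proof.
move=> sa; rewrite satisfies_reduce; apply/orP; right; apply/andP; split.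
  by apply/forallP => j; rewrite lift_wf.
have -> // : [ffun i => lift_assignment a (oldf i)] = a.
by apply/ffunP => i; rewrite ffunE lift_oldf.
Qed.

Lemma satisfies_junk i : satisfies (junk i) (reduce_cnf phi).
Proof.
rewrite satisfies_reduce; apply/orP; left; apply/forallPn; exists i.
by rewrite ffunE eqxx.
Qed.

Definition yset (A : {set 'I_d}) : {set literal (K + n)} :=
  [set (yf i, true) | i in A].

Lemma card_yset A : #|yset A| = #|A|.
Proof. by rewrite card_imset // => i j /(congr1 fst)/yf_inj. Qed.

Definition wset : {set literal (K + n)} := [set (wf j, true) | j in 'I_k.+1].

Lemma card_wset : #|wset| = k.+1.
Proof. by rewrite card_imset ?card_ord // => i j /(congr1 fst)/wf_inj. Qed.

Definition oldset (T : {set literal n}) : {set literal (K + n)} :=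
  [set (oldf l.1, l.2) | l in T].

Lemma card_oldset T : #|oldset T| = #|T|.
Proof. rewrite card_imset // => -[i b] [j e] H.
by rewrite (oldf_inj (congr1 fst H) : i = j) (congr1 snd H : b = e). Qed.

Lemma covers_setU m (a : assignment m) (A B : {set literal m}) :
  covers a (A :|: B) = covers a A && covers a B.
Proof. exact: subUset. Qed.

Lemma covers_yset a A : covers a (yset A) = [forall i in A, a (yf i)].
Proof.
apply/subsetP/forall_inP => [H i iA|H l /imsetP [i iA ->]].
  by have /H := imset_f (fun i => (yf i, true)) iA; rewrite inE => /eqP.
by rewrite inE /= H.
Qed.

Lemma covers_wset a : covers a wset = [forall j, a (wf j)].
Proof.
apply/subsetP/forallP => [H i|H l /imsetP [i iA ->]].
  have /H : (wf i, true) \in wset by apply: imset_f.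
  by rewrite inE => /eqP.
by rewrite inE /= H.
Qed.

Lemma covers_oldset a T : covers a (oldset T) = covers [ffun i => a (oldf i)] T.
Proof.
apply/subsetP/subsetP => [H l lT|H l /imsetP [i iT ->]].
  have /H := imset_f (fun l : literal n => (oldf l.1, l.2)) lT.
  by rewrite !inE ffunE.
by have := H _ iT; rewrite !inE ffunE.
Qed.

Lemma covers_lift a T :
  covers (lift_assignment a) (yset setT :|: oldset T) = covers a T.
Proof.
rewrite covers_setU covers_yset covers_oldset.
have -> : [ffun i => lift_assignment a (oldf i)] = a.
  by apply/ffunP => i; rewrite ffunE lift_oldf.
by case: forall_inP => // -[] i _; rewrite lift_yf.
Qed.

Lemma true_interaction_old T :
  true_interaction k (concrete x) T ->
  true_interaction (d + k) (concrete (reduce x)) (yset setT :|: oldset T).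
Proof.
case/andP => /eqP cT /forall_inP pT; apply/andP; split.
  rewrite cardsU card_yset card_oldset cardsT card_ord cT.
  suff -> : yset setT :&: oldset T = set0 by rewrite cards0 subn0.
  apply/setP => l; rewrite !inE; apply/andP => -[/imsetP [i _ ->] /imsetP [j _]].
  by move/(congr1 fst)/esym/eqP; rewrite oldf_yf.
apply/forall_inP => l /setUP [] /imsetP [i iT ->] /=; first exact: concrete_yf.
by have := pT _ iT; rewrite concrete_oldf.
Qed.

Lemma true_interaction_junk i :
  true_interaction (d + k) (concrete (reduce x)) (wset :|: yset [set~ i]).
Proof.
apply/andP; split.
  rewrite cardsU card_yset card_wset cardsC1 card_ord.
  suff -> : wset :&: yset [set~ i] = set0.
    by rewrite cards0 subn0; apply/eqP; have := ltn_ord i; lia.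
  apply/setP => l; rewrite !inE; apply/andP => -[/imsetP [j _ ->] /imsetP [j' _]].
  by move/(congr1 fst)/eqP; rewrite wf_yf.
apply/forall_inP => l /setUP [] /imsetP [j _ ->] /=; first exact: concrete_wf.
exact: concrete_yf.
Qed.

Lemma covers_junk i (T : {set literal (K + n)}) :
  (forall l, l \in T -> l.2) -> (yf i, true) \notin T -> covers (junk i) T.
Proof.
move=> pT niT; apply/subsetP => -[f b] fT; rewrite inE ffunE /=.
move: (pT _ fT) => /= eb; rewrite eb in fT *; rewrite eqb_id.
by apply: contraNneq niT => <-.
Qed.

(** An assignment covering [T] makes all [y]'s true, so it falsifies the [w]'s and its restriction
    satisfies [phi]. Hence [T] contains no [w], and counting leaves [k] old literals. *)
Lemma interaction_split T :
  true_interaction (d + k) (concrete (reduce x)) T ->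
  feasible (reduce_cnf phi) T -> (forall i, (yf i, true) \in T) ->
  exists T0, [/\ true_interaction k (concrete x) T0, feasible phi T0
               & T = yset setT :|: oldset T0].
Proof.
case/andP => /eqP cT /forall_inP pT [a [sa caT]] yT.
pose T0 := [set l : literal n | (oldf l.1, l.2) \in T].
have aT l : l \in T -> a l.1 by move=> lT; have := subsetP caT _ lT;
  rewrite inE; have /andP [-> _] := pT _ lT => /eqP.
have ay : all_y a by apply/forallP => i; exact: (aT _ (yT i)).
move: sa; rewrite satisfies_reduce ay /= => /andP [/forallP aw sa].
have eT : T = yset setT :|: oldset T0.
  apply/setP => -[f b]; apply/idP/setUP => [fT|].
    have /andP [/= eb _] := pT _ fT; rewrite eb in fT *.
    case: (featureP f) fT => [i|j|i] fT.
    - by left; apply/imsetP; exists i.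
    - by have := aT _ fT; rewrite /= (negbTE (aw j)).
    - by right; apply/imsetP; exists (i, true); rewrite ?inE.
  case=> /imsetP [i iT [-> ->]] //; by rewrite inE in iT.
exists T0; split=> //; last first.
  exists [ffun i => a (oldf i)]; split=> //.
  by move: caT; rewrite eT covers_setU covers_oldset => /andP [].
apply/andP; split; last first.
  by apply/forall_inP => l; rewrite inE => /pT /=; rewrite concrete_oldf.
move: cT; rewrite {1}eT cardsU card_yset card_oldset cardsT card_ord.
suff -> : yset setT :&: oldset T0 = set0.
  by rewrite cards0 subn0 => /addnI ->.
apply/setP => l; rewrite !inE; apply/andP => -[/imsetP [i _ ->] /imsetP [j _]].
by move/(congr1 fst)/esym/eqP; rewrite oldf_yf.
Qed.

Lemma reduce_sound : isp_ot_yes k x -> isp_ot_yes (d + k) (reduce x).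
Proof.
case=> S [cS sS covS].
exists ([set junk i | i in 'I_d] :|: [set lift_assignment a | a in S]); split.
- rewrite /= (leq_trans (leq_card_setU _ _)) // leq_add //.
    by rewrite (leq_trans (leq_imset_card _ _)) // card_ord.
  by rewrite (leq_trans (leq_imset_card _ _)).
- move=> a /setUP [/imsetP [i _ ->]|/imsetP [b bS ->]].
    exact: satisfies_junk.
  by apply: satisfies_lift; apply: sS.
move=> T iT fT; have [/forallP yT|/forallPn [i niT]] :=
  boolP [forall i, (yf i, true) \in T].
  have [T0 [iT0 fT0 ->]] := interaction_split iT fT yT.
  have [a aS aT] := covS _ iT0 fT0.
  by exists (lift_assignment a); rewrite ?covers_lift // inE imset_f ?orbT.
exists (junk i); first by rewrite inE imset_f.
by apply: covers_junk => // l /(forall_inP (proj2 (andP iT))) /andP [].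
Qed.

(* Every solution contains, for each [i], an assignment falsifying exactly
   [y_i] among the [y]'s; these [d] assignments cannot serve [phi]. *)
Lemma reduce_complete : isp_ot_yes (d + k) (reduce x) -> isp_ot_yes k x.
Proof.
case=> S [/= cS sS covS].
pose S0 := [set a in S | all_y a].
have junkS i : exists a, (a \in S) && [forall j, a (yf j) == (j != i)].
  (* This interaction is feasible because [junk i] covers it. *)
  have [|a aS] := covS _ (true_interaction_junk i).
    exists (junk i); split; first exact: satisfies_junk.
    apply: covers_junk => [l /setUP [] /imsetP [j _ ->] //|].
    rewrite !inE negb_or; apply/andP; split; apply/imsetP => -[j].
      by move=> _ /(congr1 fst)/esym/eqP; rewrite wf_yf.
    by rewrite !inE => ji /(congr1 fst)/yf_inj ij; rewrite ij eqxx in ji.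
  rewrite covers_setU covers_wset covers_yset => /andP [/forallP aw /forall_inP ay].
  exists a; rewrite aS; apply/forallP => j; have [->|ji] := eqVneq j i; last first.
    by rewrite ay ?inE.
  (* If [y_i] were true, all [y]'s would be, and the gadget would falsify [wf ord0], which [a] makes
     true. *)
  apply/negPn; rewrite eqbF_neg negbK; apply/negP => ai.
  have: satisfies a (reduce_cnf phi) by exact: sS.
  rewrite satisfies_reduce; case/orP => [/forallPn [l]|/andP [/forallP H _]].
    by have [->|li] := eqVneq l i; rewrite ?ai // ay ?inE.
  by have := H ord0; rewrite aw.
pose g i := xchoose (junkS i).
have gP i : g i \in S /\ forall j, g i (yf j) = (j != i).
  by have /andP [giS /forallP H] := xchooseP (junkS i); split=> // j; apply/eqP.
(* The index [i] is recovered from [g i] as that of its only false [y]. *)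
have g_inj : injective g.
  move=> i j e; apply/eqP; have := (gP j).2 i; rewrite -e (gP i).2 eqxx.
  by move/esym/negbFE.
exists [set [ffun i => a (oldf i)] | a : assignment (K + n) in S0]; split.
- apply: leq_trans (leq_imset_card _ _) _; rewrite -(leq_add2l d).
  apply: leq_trans cS; rewrite -{1}(card_ord d) -(card_imset predT g_inj).
  (* The [d] assignments [g i] lie in [S] but outside [S0], so [d + #|S0|] is at most [#|S|]. *)
  have <- : #|(g @: 'I_d) :|: S0| = #|g @: 'I_d| + #|S0|.
    rewrite cardsU; suff -> : g @: 'I_d :&: S0 = set0 by rewrite cards0 subn0.
    apply/setP => a; rewrite !inE; apply/and3P => -[/imsetP [i _ ->] _ /forallP].
    by move/(_ i); rewrite (gP i).2 eqxx.
  apply/subset_leq_card/subsetP => a /setUP [/imsetP [i _ ->]|].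
    exact: (gP i).1.
  by rewrite inE => /andP [].
- move=> b /imsetP [a]; rewrite inE => /andP [aS ay] ->.
  by have := sS _ aS; rewrite satisfies_reduce ay => /andP [].
move=> T iT [a [sa aT]].
(* Whatever covers [T] extended by all [y]'s makes them all true, hence belongs to [S0]. *)
have [|b bS] := covS _ (true_interaction_old iT).
  exists (lift_assignment a); rewrite covers_lift; split=> //.
  exact: satisfies_lift.
rewrite covers_setU covers_yset covers_oldset => /andP [/forall_inP yb bT].
exists [ffun i => b (oldf i)] => //; apply: imset_f; rewrite inE bS.
by apply/forallP => i; exact: yb.
Qed.

End Correctness.
End Reduction.

Theorem theorem4p4 (t' t : nat) (ht' : 2 <= t') (htt : t' <= t) :
  polytime_many_one_reducible (isp_ot t') (isp_ot t).
Proof.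
exists (reduce (t - t') t'); split; first exact: reduce_polytime.
rewrite -[in isp_ot t](subnK htt) => x.
by split; [apply: reduce_sound | apply: reduce_complete].
Qed.
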